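(* Let $\Bbbk$ be a field. If $G$ is a bipartite graph with maximum degree $\Delta(G)\le 3$ and at least $3$ vertices that is prime over $\Bbbk$, then $G$ is $2$-connected.
   Context: $\operatorname{reg}_{\Bbbk}(G)=\max\{j\ge0:\widetilde H_{j-1}(\operatorname{Ind}(G[S]);\Bbbk)\neq0\text{ for some }S\subseteq V(G)\}$, $\operatorname{Ind}$ the independence complex. A connected graph $G$ is prime over $\Bbbk$ if $\operatorname{reg}_{\Bbbk}(G-x)<\operatorname{reg}_{\Bbbk}(G)$ for every vertex $x$. *)

(* Defs.v *)
From HB Require Import structures.
From mathcomp Require Import all_boot all_order all_algebra.
Set Implicit Arguments. Unset Strict Implicit. Unset Printing Implicit Defensive.
Import GRing.Theory.
Local Open Scope ring_scope.

Section Graphs.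
Variable T : finType.
Variable e : rel T.

Definition simple_graph : Prop := symmetric e /\ irreflexive e.

Definition independent (A : {set T}) : bool :=
  [forall u in A, forall v in A, ~~ e u v].

(* faces of Ind(G[S]) with exactly j vertices (i.e. of dimension j-1);
   the empty face is the unique face with 0 vertices *)
Definition faces (S : {set T}) (j : nat) : seq {set T} :=
  [seq A : {set T} <- enum [set: {set T}] | [&& A \subset S, independent A & #|A| == j]].

Definition pos (A : {set T}) (v : T) : nat :=
  #|[set u in A | (enum_rank u < enum_rank v)%N]|.

Variable K : fieldType.

Definition bd_coef (A B : {set T}) : K :=
  \sum_(v in A) (if B == A :\ v then (-1) ^+ pos A v else 0).

(* boundary map C_{j-1} -> C_{j-2} of the augmented chain complex of
   Ind(G[S]) (chains indexed by faces with j vertices), as a matrix acting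
   on row vectors; for j = 0 it is the zero map *)
Definition bd (S : {set T}) (j : nat) :
  'M[K]_(size (faces S j), size (faces S j.-1)) :=
  \matrix_(a < size (faces S j), b < size (faces S j.-1))
     bd_coef (nth set0 (faces S j) a) (nth set0 (faces S j.-1) b).

(* reduced homology  H~_{j-1}(Ind(G[S]); K) is nonzero:
   dim C_{j-1} - rank d_{j-1} - rank d_j > 0 *)
Definition red_hom_nonzero (S : {set T}) (j : nat) : bool :=
  (\rank (bd S j) + \rank (bd S j.+1) < size (faces S j))%N.

(* reg_K of the induced subgraph G[V]:
   max { j >= 0 : H~_{j-1}(Ind(G[S]);K) <> 0 for some S subset V }.
   Faces have at most #|T| vertices, so j ranges over j < #|T|.+2. *)
Definition reg (V : {set T}) : nat :=
  \max_(S : {set T} | S \subset V) \max_(j < #|T|.+2 | red_hom_nonzero S j) j.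

Definition connected_on (V : {set T}) : Prop :=
  V != set0 /\
  forall x y, x \in V -> y \in V ->
    connect (fun u v => [&& e u v, u \in V & v \in V]) x y.

Definition connected_graph : Prop := connected_on setT.

Definition prime_graph : Prop :=
  connected_graph /\ forall x : T, (reg (setT :\ x) < reg setT)%N.

Definition bipartite : Prop :=
  exists f : T -> bool, forall x y, e x y -> f x != f y.

Definition max_degree_le (d : nat) : Prop :=
  forall x : T, (#|[set y | e x y]| <= d)%N.

Definition two_connected : Prop :=
  (3 <= #|T|)%N /\ connected_graph /\ forall x : T, connected_on (setT :\ x).

End Graphs.

(* Main.v *)
(** A prime graph on at least three vertices has no bridge [x y].  Let [A], [B] be
    the two sides of the bridge and put [P = A - N[x]], [P' = A - x], [Q = B - y],
    [Q' = B - N[y]].  Since deleting [x] or [y] lowers [r = reg G], the exact sequence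
    of link and deletion gives [r - 1 <= reg P + reg Q] and [r - 1 <= reg P' + reg Q'],
    while [reg P' + reg B = reg (G - x) <= r - 1].  With [reg P <= reg P'] and
    [reg Q <= reg B] this forces [reg P + reg Q' >= r - 1], so the induced subgraph on
    [P], [Q'] and the edge [x y], which misses a neighbour of [x] in [A], has
    regularity at least [r].  In a graph of maximum degree at most 3, one of the
    two sides of a cut vertex contains only one of its neighbours, which yields a bridge.

    Additivity of the regularity on disjoint unions is Kunneth's formula over a field,
    obtained from explicit homotopies (upper bound) and a cocycle pairing (lower bound). *)

Require Import Defs.
From HB Require Import structures.
From mathcomp Require Import all_boot all_order all_algebra.
From mathcomp Require Import zify.
Set Implicit Arguments. Unset Strict Implicit. Unset Printing Implicit Defensive.
Import GRing.Theory.

(** * Contraction, exterior multiplication and the simplicial boundary *)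

Section Koszul.
Local Open Scope ring_scope.
Variables (T : finType) (K : fieldType).
Implicit Types (A B : {set T}) (u v : T).
Local Notation N := #|{: {set T}}|.
Local Notation rk := (@enum_rank {set T}).

Definition sg B v : K := (-1) ^+ pos B v.

Lemma sgM B v : sg B v * sg B v = 1.
Proof. by rewrite -expr2 sqrr_sign. Qed.

Lemma posE A v : pos A v = (\sum_(u in A) (enum_rank u < enum_rank v)%N)%N.
Proof.
rewrite /pos -sum1_card [RHS]big_mkcond [LHS]big_mkcond /=; apply: eq_bigr => u _.
by rewrite inE; case: (u \in A) => //; case: ltnP.
Qed.

Lemma sgU1 B u v : v \notin B ->
  sg (v |: B) u = sg B u * (-1) ^+ (enum_rank v < enum_rank u)%N.
Proof. by move=> vB; rewrite /sg !posE big_setU1 //= addnC exprD. Qed.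

Lemma sgU1v B v : v \notin B -> sg (v |: B) v = sg B v.
Proof. by move=> vB; rewrite sgU1 // ltnn expr0 mulr1. Qed.

Lemma sgD1v B v : v \in B -> sg (B :\ v) v = sg B v.
Proof. by move=> vB; rewrite -{2}(setD1K vB) sgU1v ?setD11. Qed.

Lemma sgU A B v : [disjoint A & B] -> sg (A :|: B) v = sg A v * sg B v.
Proof.
move=> dAB; rewrite /sg !posE -exprD; congr (_ ^+ _).
by rewrite (eq_bigl _ _ (fun u => in_setU u A B)) bigU.
Qed.

Lemma sg_anti u v : u != v ->
  (-1) ^+ (enum_rank u < enum_rank v)%N =
  - (-1) ^+ (enum_rank v < enum_rank u)%N :> K.
Proof.
rewrite -(inj_eq enum_rank_inj) -val_eqE /= => uv.
by case: ltngtP uv => //= _ _; rewrite ?expr0 ?expr1 ?opprK.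
Qed.

(** Operators act from the right on row vectors indexed by all subsets of [T], so one matrix size
    serves every degree and every vertex set; restriction to faces becomes a support condition. *)
Definition kmx (f : {set T} -> {set T} -> K) : 'M[K]_N :=
  \matrix_(i, j) f (enum_val i) (enum_val j).

Lemma mul_kmx m (M : 'M_(m, N)) f i B :
  (M *m kmx f) i (rk B) = \sum_A M i (rk A) * f A B.
Proof.
rewrite mxE (reindex _ (onW_bij _ (@enum_rank_bij _))) /=.
by apply: eq_bigr => A _; rewrite mxE !enum_rankK.
Qed.

Lemma chain_ext m (M M' : 'M[K]_(m, N)) :
  (forall i B, M i (rk B) = M' i (rk B)) -> M = M'.
Proof. by move=> H; apply/matrixP => i j; rewrite -(enum_valK j). Qed.

(** The span of all subsets is the exterior algebra on [T]: [ctr v] is the interior product with the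
    coordinate form of [v], and [wdg v] is left multiplication by [v]. *)
Definition ctr v := kmx (fun A B => if (v \in A) && (B == A :\ v) then sg A v else 0).
Definition wdg v := kmx (fun A B => if (v \notin A) && (B == v |: A) then sg A v else 0).
Definition bdm := kmx (@bd_coef T K).

Lemma sum_only (B : {set T}) (F : {set T} -> K) :
  (forall A, A != B -> F A = 0) -> \sum_A F A = F B.
Proof. by move=> F0; rewrite (bigD1 B) //= big1 ?addr0. Qed.

Lemma ctrE m (M : 'M_(m, N)) v i B :
  (M *m ctr v) i (rk B) = if v \in B then 0 else sg B v * M i (rk (v |: B)).
Proof.
rewrite mul_kmx; case: ifPn => vB.
  rewrite big1 // => A _; case: ifP; rewrite ?mulr0 // => /andP[_ /eqP BE].
  by move: vB; rewrite BE !inE eqxx.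
rewrite (sum_only (B := v |: B)) => [|A AB].
  by rewrite setU11 setU1K // eqxx sgU1v // mulrC.
case: ifP; rewrite ?mulr0 // => /andP[vA /eqP BE].
by rewrite BE setD1K ?eqxx in AB.
Qed.

Lemma wdgE m (M : 'M_(m, N)) v i B :
  (M *m wdg v) i (rk B) = if v \in B then sg B v * M i (rk (B :\ v)) else 0.
Proof.
rewrite mul_kmx; case: ifPn => vB; last first.
  rewrite big1 // => A _; case: ifP; rewrite ?mulr0 // => /andP[_ /eqP BE].
  by move: vB; rewrite BE !inE eqxx.
rewrite (sum_only (B := B :\ v)) => [|A AB].
  by rewrite setD11 setD1K // eqxx sgD1v // mulrC.
case: ifP; rewrite ?mulr0 // => /andP[vA /eqP BE].
by rewrite BE setU1K ?eqxx in AB.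
Qed.

Lemma bdm_sum : bdm = \sum_v ctr v.
Proof.
apply/matrixP => i j; rewrite summxE mxE /bd_coef big_mkcond; apply: eq_bigr => v _.
by rewrite mxE; case: (v \in _).
Qed.

Lemma bdmE m (M : 'M_(m, N)) i B :
  (M *m bdm) i (rk B) = \sum_(v | v \notin B) sg B v * M i (rk (v |: B)).
Proof.
rewrite bdm_sum mulmx_sumr summxE [RHS]big_mkcond; apply: eq_bigr => v _.
by rewrite ctrE; case: (v \in B).
Qed.

Lemma ctr_anti u v : ctr u *m ctr v = - (ctr v *m ctr u).
Proof.
rewrite -[ctr u in LHS]mul1mx -[ctr v in RHS]mul1mx; apply: chain_ext => i B.
rewrite [RHS]mxE !ctrE !in_setU1.
have [->|uv] /= := eqVneq u v; first by rewrite !mulr0 if_same oppr0.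
case: ifPn => vB; case: ifPn => uB; rewrite ?mulr0 ?oppr0 //=.
rewrite (setUCA [set u]) !sgU1 // (sg_anti uv) !(mulrN, mulNr) opprK.
by rewrite !mulrA [sg B v * sg B u]mulrC.
Qed.

(** This does not follow from anticommutation in characteristic 2, hence a separate argument:
    nothing remains to contract after [v] has been removed. *)
Lemma ctr_ctr v : ctr v *m ctr v = 0.
Proof.
rewrite -[X in X *m _ = _]mul1mx; apply: chain_ext => i B.
by rewrite !ctrE setU11 mulr0 if_same mxE.
Qed.

Lemma ctr_wdg v : ctr v *m wdg v + wdg v *m ctr v = 1%:M.
Proof.
rewrite -[ctr v in X in X + _]mul1mx -[wdg v in X in _ + X]mul1mx.
apply: chain_ext => i B; rewrite mxE ctrE !wdgE.
case: ifPn => vB.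
  by rewrite ctrE setD11 setD1K // sgD1v // mulrA sgM mul1r addr0.
by rewrite setU11 setU1K // sgU1v // mulrA sgM mul1r add0r.
Qed.

Lemma bdm_ctr v : bdm *m ctr v = - (ctr v *m bdm).
Proof.
rewrite bdm_sum mulmx_suml mulmx_sumr -sumrN.
by apply: eq_bigr => u _; rewrite ctr_anti.
Qed.

(** The diagonal terms vanish, and the terms with [u] before [v] cancel those with [v] before [u];
    pairing them avoids a division by 2. *)
Lemma bdm_bdm : bdm *m bdm = 0.
Proof.
rewrite {1}bdm_sum mulmx_suml.
under eq_bigr => u _ do rewrite bdm_sum mulmx_sumr.
pose lt u v := (enum_rank u < enum_rank v)%N.
rewrite (eq_bigr (fun u => \sum_(v | lt u v) ctr u *m ctr v +
                           \sum_(v | lt v u) ctr u *m ctr v)); last first.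
  move=> u _; rewrite (bigID (lt u)) /=; congr (_ + _).
  rewrite (bigD1 u) ?/lt ?ltnn //= ctr_ctr add0r; apply: eq_bigl => v.
  rewrite -leqNgt leq_eqVlt -(inj_eq enum_rank_inj) -val_eqE /=.
  by case: ltngtP.
rewrite big_split /= [X in _ + X](exchange_big_dep predT) //= -big_split big1 // => u _.
by rewrite -big_split big1 // => v _; rewrite ctr_anti /= addNr.
Qed.

Lemma bdmK m (M : 'M_(m, N)) : M *m bdm *m bdm = 0.
Proof. by rewrite -mulmxA bdm_bdm mulmx0. Qed.
End Koszul.

(** * Homology as cycles modulo boundaries *)

Section Homology.
Local Open Scope ring_scope.
Variables (T : finType) (e : rel T) (K : fieldType).
Implicit Types (A B S : {set T}) (u v : T) (i j : nat).
Local Notation N := #|{: {set T}}|.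
Local Notation rk := (@enum_rank {set T}).
Local Notation d := (bdm T K).

Definition face S j A := [&& A \subset S, independent e A & #|A| == j].

(** Several rows are allowed, so that operators such as [emb] are covered along with single
    chains. *)
Definition chain m S j (M : 'M[K]_(m, N)) :=
  forall a B, ~~ face S j B -> M a (rk B) = 0.

Definition acyclic S j := forall z : 'rV[K]_N, chain S j z -> z *m d = 0 ->
  exists2 w : 'rV_N, chain S j.+1 w & w *m d = z.

Lemma independentS A B : A \subset B -> independent e B -> independent e A.
Proof.
move=> /subsetP AB /forall_inP iB; apply/forall_inP => u uA.
by apply/forall_inP => v vA; move/forall_inP: (iB _ (AB _ uA)); apply; apply: AB.
Qed.

Lemma face_setU1 S j v B : v \notin B -> face S j.+1 (v |: B) -> face S j B.
Proof.
move=> vB /and3P[sS iB]; rewrite cardsU1 vB add1n eqSS => cB.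
by rewrite /face cB (subset_trans (subsetUr _ _) sS) (independentS (subsetUr _ _) iB).
Qed.

Lemma chain_bdm m S j (M : 'M_(m, N)) : chain S j.+1 M -> chain S j (M *m d).
Proof.
move=> cM a B nB; rewrite bdmE big1 // => v vB; rewrite cM ?mulr0 //.
by apply: contra nB; apply: face_setU1.
Qed.

Lemma chain_bdm0 m S (M : 'M_(m, N)) : chain S 0 M -> M *m d = 0.
Proof.
move=> cM; apply: chain_ext => a B; rewrite bdmE mxE big1 // => v vB.
by rewrite cM ?mulr0 // /face cardsU1 vB /= !andbF.
Qed.

Lemma chainD m S j (M M' : 'M_(m, N)) : chain S j M -> chain S j M' -> chain S j (M + M').
Proof. by move=> cM cM' a B nB; rewrite mxE cM ?cM' ?addr0. Qed.

Lemma chainN m S j (M : 'M_(m, N)) : chain S j M -> chain S j (- M).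
Proof. by move=> cM a B nB; rewrite mxE cM ?oppr0. Qed.

Lemma faceS S S' j A : S \subset S' -> face S j A -> face S' j A.
Proof. by move=> sS /and3P[AS iA cA]; rewrite /face (subset_trans AS sS) iA. Qed.

Lemma chainS m S S' j (M : 'M_(m, N)) : S \subset S' -> chain S j M -> chain S' j M.
Proof. by move=> sS cM a B nB; apply: cM; apply: contra nB; apply: faceS. Qed.

(* Embeds the coordinates used by [bd] into chains on the full power set. *)
Definition emb S j : 'M[K]_(size (faces e S j), N) :=
  \matrix_(a, b) (nth set0 (faces e S j) a == enum_val b)%:R.

Lemma mem_faces S j A : (A \in faces e S j) = face S j A.
Proof. by rewrite mem_filter mem_enum inE andbT. Qed.

Lemma uniq_faces S j : uniq (faces e S j).
Proof. by rewrite filter_uniq ?enum_uniq. Qed.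

Lemma nth_faces S j (a : 'I_(size (faces e S j))) : face S j (nth set0 (faces e S j) a).
Proof. by rewrite -mem_faces mem_nth. Qed.

Lemma mul_emb m S j (M : 'M_(m, size (faces e S j))) b (a : 'I_(size (faces e S j))) :
  (M *m emb S j) b (rk (nth set0 (faces e S j) a)) = M b a.
Proof.
rewrite mxE (bigD1 a) //= mxE enum_rankK eqxx mulr1 big1 ?addr0 // => c ca.
by rewrite mxE enum_rankK nth_uniq ?uniq_faces // (inj_eq val_inj) (negPf ca) mulr0.
Qed.

Lemma chain_emb m S j (M : 'M_(m, size (faces e S j))) : chain S j (M *m emb S j).
Proof.
move=> b B nB; rewrite mxE big1 // => a _; rewrite mxE enum_rankK.
by case: eqP nB => [<-|]; rewrite ?nth_faces ?mulr0.
Qed.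

Lemma face_nth S j B : face S j B ->
  exists a : 'I_(size (faces e S j)), nth set0 (faces e S j) a = B.
Proof.
rewrite -mem_faces => fB; have lt := fB; rewrite -index_mem in lt.
by exists (Ordinal lt); rewrite /= nth_index.
Qed.

Lemma eq_chain m S j (M M' : 'M[K]_(m, N)) : chain S j M -> chain S j M' ->
  (forall a B, face S j B -> M a (rk B) = M' a (rk B)) -> M = M'.
Proof.
move=> cM cM' H; apply: chain_ext => a B; case: (boolP (face S j B)) => [/H //|nB].
by rewrite cM ?cM'.
Qed.

Lemma embK m S j (M : 'M_(m, size (faces e S j))) : M *m emb S j *m (emb S j)^T = M.
Proof.
apply/matrixP => b a; rewrite mxE (reindex _ (onW_bij _ (@enum_rank_bij _))) /=.
rewrite (sum_only (B := nth set0 (faces e S j) a)).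
  by rewrite mul_emb !mxE enum_rankK eqxx mulr1.
by move=> A Aa; rewrite !mxE enum_rankK eq_sym (negPf Aa) mulr0.
Qed.

Lemma chainK m S j (M : 'M_(m, N)) : chain S j M -> M *m (emb S j)^T *m emb S j = M.
Proof.
move=> cM; apply: (eq_chain (chain_emb _) cM) => b B /face_nth[a <-].
rewrite mul_emb mxE (reindex _ (onW_bij _ (@enum_rank_bij _))) /=.
rewrite (sum_only (B := nth set0 (faces e S j) a)).
  by rewrite !mxE enum_rankK eqxx mulr1.
by move=> A Aa; rewrite !mxE enum_rankK eq_sym (negPf Aa) mulr0.
Qed.

Lemma bd_emb S j : bd e K S j *m emb S j.-1 = emb S j *m d.
Proof.
have cE : chain S j (emb S j) by rewrite -[emb S j]mul1mx; apply: chain_emb.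
have cd : chain S j.-1 (emb S j *m d).
  (* For [j = 0] the index [j.-1] is again 0, and the boundary is zero. *)
  case: j cE => [|j] cE; last exact: chain_bdm.
  by rewrite (chain_bdm0 cE) => a B _; rewrite mxE.
apply: (eq_chain (chain_emb _) cd) => b B /face_nth[a <-].
rewrite mul_emb mxE mul_kmx (sum_only (B := nth set0 (faces e S j) b)).
  by rewrite mxE enum_rankK eqxx mul1r.
by move=> A Ab; rewrite mxE enum_rankK eq_sym (negPf Ab) mul0r.
Qed.

Lemma emb_inj m S j (M M' : 'M_(m, size (faces e S j))) :
  M *m emb S j = M' *m emb S j -> M = M'.
Proof. by move=> /(congr1 (mulmx^~ (emb S j)^T)); rewrite !embK. Qed.

Lemma bd_bd S j : bd e K S j.+1 *m bd e K S j = 0.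
Proof.
apply: emb_inj; rewrite -mulmxA bd_emb mulmxA -[j in emb S j]/(j.+1.-1) bd_emb.
by rewrite bdmK mul0mx.
Qed.

(** Boundaries lie among cycles, and by rank-nullity the failed strict inequality makes the two
    spaces equal in dimension. *)
Lemma red_homN S j : ~~ red_hom_nonzero e K S j ->
  (kermx (bd e K S j) <= bd e K S j.+1)%MS.
Proof.
rewrite /red_hom_nonzero -leqNgt => le.
have sub : (bd e K S j.+1 <= kermx (bd e K S j))%MS by apply/sub_kermxP; exact: bd_bd.
by rewrite -(geq_leqif (mxrank_leqif_sup sub)) mxrank_ker leq_subLR.
Qed.

Lemma red_homP S j : red_hom_nonzero e K S j ->
  ~~ (kermx (bd e K S j) <= bd e K S j.+1)%MS.
Proof.
rewrite /red_hom_nonzero ltnNge; apply: contra => /mxrankS.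
by rewrite mxrank_ker leq_subLR.
Qed.

Lemma red_homN_acyclic S j : ~~ red_hom_nonzero e K S j -> acyclic S j.
Proof.
move=> /red_homN sub z cz zd; pose z' := z *m (emb S j)^T.
have z'K : z' *m emb S j = z by apply: chainK.
have /sub_kermxP k : z' *m bd e K S j = 0.
  by apply: emb_inj; rewrite -mulmxA bd_emb mulmxA z'K zd mul0mx.
have /submxP[w w'E] := submx_trans k sub.
exists (w *m emb S j.+1); first exact: chain_emb.
by rewrite -mulmxA -bd_emb mulmxA -w'E.
Qed.

(** A nonzero homology class is detected by a cocycle: [h] is a cycle, [om] a functional on faces
    with [j] vertices that kills boundaries, and their pairing is 1. *)
Lemma red_hom_cocycle S j : red_hom_nonzero e K S j ->
  exists h : 'rV[K]_N, exists om : 'cV[K]_N,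
  [/\ chain S j h, h *m d = 0, h *m om = 1%:M,
      forall B, ~~ face S j B -> om (rk B) 0 = 0 &
      forall m (w : 'M_(m, N)), chain S j.+1 w -> w *m d *m om = 0].
Proof.
move=> /red_homP; rewrite submxE => /matrix0Pn[a [b nz]].
set k := kermx _ in nz; set c := cokermx _ in nz.
(* A nonzero entry of kernel times cokernel selects a cycle (row [a]) and a functional vanishing on
   boundaries (column [b]); dividing by [x] normalises their pairing. *)
pose x := (k *m c) a b.
exists (row a k *m emb S j), ((emb S j)^T *m (x^-1 *: col b c)).
have E : row a k *m col b c = x%:M.
  by apply/matrixP => p q; rewrite !ord1 !mxE eqxx /x mxE; apply: eq_bigr => t _; rewrite !mxE.
split.
- exact: chain_emb.
- by rewrite -mulmxA -bd_emb mulmxA -row_mul mulmx_ker row0 mul0mx.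
- by rewrite mulmxA embK -scalemxAr E scale_scalar_mx mulVf.
- move=> B nB; rewrite mxE big1 // => p _; rewrite !mxE enum_rankK.
  by case: eqP nB => [<-|]; rewrite ?nth_faces ?mul0r.
move=> m w cw; rewrite -(chainK cw) -(mulmxA _ (emb _ _)) -bd_emb /= !mulmxA embK.
rewrite -mulmxA -scalemxAr colE (mulmxA (bd _ _ _ _)).
by rewrite mulmx_coker mul0mx scaler0 ?mulmx0.
Qed.

Lemma acyclic_red_homN S j : acyclic S j -> ~~ red_hom_nonzero e K S j.
Proof.
move=> ac; apply/negP => /red_hom_cocycle[h [om [ch hd ho _ H]]].
have [w cw wd] := ac h ch hd.
have := H _ _ cw; rewrite wd ho => /matrixP/(_ 0 0); rewrite !mxE eqxx => /eqP.
by rewrite oner_eq0.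
Qed.

End Homology.

(** * Link and deletion; homotopies *)

Section LinkDeletion.
Local Open Scope ring_scope.
Variables (T : finType) (e : rel T) (K : fieldType).
Implicit Types (A B S : {set T}) (u v : T) (i j : nat).
Local Notation N := #|{: {set T}}|.
Local Notation rk := (@enum_rank {set T}).
Local Notation d := (bdm T K).
Hypothesis se : simple_graph e.

(** This is [S] minus the closed neighbourhood of [x]; for [x] in [S], its independence complex is
    the link of [x]. *)
Definition nbd_compl S x := [set y in S | (y != x) && ~~ e x y].

Lemma independent_setU1 x A : x \notin A ->
  independent e (x |: A) = independent e A && [forall a in A, ~~ e x a].
Proof.
case: se => sym irr xA; apply/idP/andP => [iA|[/forall_inP iA /forall_inP xN]].
  split; first exact: independentS (subsetUr _ _) iA.
  apply/forall_inP => a aA; move/forall_inP: iA => /(_ x (setU11 _ _)) /forall_inP; apply.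
  by rewrite setU1r.
apply/forall_inP => u /setU1P[->|uA]; apply/forall_inP => v /setU1P[->|vA].
- by rewrite irr.
- exact: xN.
- by rewrite sym xN.
- by move/forall_inP: (iA u uA); apply.
Qed.

Lemma face_link S x j B : x \in S -> x \notin B ->
  face e S j.+1 (x |: B) = face e (nbd_compl S x) j B.
Proof.
move=> xS xB; rewrite /face cardsU1 xB add1n eqSS independent_setU1 // subUset sub1set xS /=.
case: (independent e B); rewrite ?andbF //=; case: (#|B| == j); rewrite ?andbF ?andbT //.
apply/andP/subsetP => [[/subsetP BS /forall_inP xN] b bB|H].
  by rewrite inE BS // xN // andbT; apply: contraNneq xB => <-.
split; first by apply/subsetP => b /H; rewrite inE => /andP[].
by apply/forall_inP => b /H; rewrite inE => /and3P[].
Qed.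

(** Exactness of the link-deletion sequence, done on chains: contracting [z] by [x] gives a cycle of
    the link, bounded by some [v]; adding the boundary of [x] wedge [v] to [z] removes all faces
    through [x], and the resulting cycle is filled in the deletion. *)
Lemma acyclic_link_deletion S x j : x \in S ->
  acyclic e K (S :\ x) j.+1 -> acyclic e K (nbd_compl S x) j -> acyclic e K S j.+1.
Proof.
move=> xS acD acL z cz zd.
have cu : chain e (nbd_compl S x) j (z *m ctr K x).
  move=> a B nB; rewrite ctrE; case: ifPn => // xB.
  by rewrite cz ?mulr0 // face_link.
have [|v cv vd] := acL _ cu; first by rewrite -mulmxA -[_ *m d]opprK -bdm_ctr mulmxN mulmxA
  zd mul0mx oppr0.
have cvx : chain e S j.+2 (v *m wdg K x).
  move=> a B nB; rewrite wdgE; case: ifPn => // xB.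
  by rewrite cv ?mulr0 // -face_link ?setD11 // setD1K.
have vc : v *m ctr K x = 0.
  apply: chain_ext => a B; rewrite ctrE mxE; case: ifPn => // xB.
  rewrite cv ?mulr0 // /face subUset sub1set inE eqxx andbF //.
pose z1 := z + v *m wdg K x *m d.
have z1c : z1 *m ctr K x = 0.
  rewrite mulmxDl -(mulmxA _ d) bdm_ctr mulmxN -mulmxA (mulmxA _ (ctr K x)).
  have -> : wdg K x *m ctr K x = 1%:M - ctr K x *m wdg K x.
    by rewrite -(ctr_wdg K x) addrAC subrr add0r.
  rewrite mulmxBl mul1mx mulmxBr -mulmxA (mulmxA v) vc !mul0mx subr0.
  by rewrite vd subrr.
have cz1 : chain e (S :\ x) j.+1 z1.
  have cz1 : chain e S j.+1 z1 by apply: chainD cz (chain_bdm cvx).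
  move=> a B nB; case: (boolP (x \in B)) => xB.
    (* Up to sign, the coefficient of [z1] at a face containing [x] is a coefficient of its
       contraction, which is zero. *)
    have := ctrE z1 x a (B :\ x); rewrite setD11 z1c setD1K // mxE => /esym/eqP.
    by rewrite mulf_eq0 /sg signr_eq0 => /eqP.
  apply: cz1; apply: contra nB => /and3P[BS iB cB]; apply/and3P; split=> //.
  by rewrite subsetD1 BS.
have [|w cw wd] := acD _ cz1; first by rewrite mulmxDl zd bdmK addr0.
exists (w - v *m wdg K x).
  by apply: chainD (chainN cvx); apply: chainS cw; apply: subsetDl.
by rewrite mulmxBl wd addrK.
Qed.

End LinkDeletion.

(** * Contracting homotopies above a given degree *)

Section Homotopy.
Local Open Scope ring_scope.
Variables (T : finType) (e : rel T) (K : fieldType).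
Implicit Types (A B S : {set T}) (u v : T) (i j : nat).
Local Notation N := #|{: {set T}}|.
Local Notation rk := (@enum_rank {set T}).
Local Notation d := (bdm T K).

Definition raises S (k : 'M[K]_N) := forall A B,
  ~~ (face e S #|A| A && face e S #|A|.+1 B) -> k (rk A) (rk B) = 0.

Lemma face_card S j A : face e S j A -> #|A| = j.
Proof. by case/and3P=> _ _ /eqP. Qed.

Lemma chain_rows m S j (z : 'M[K]_(m, N)) (k k' : 'M_N) :
  (forall A B, face e S j A -> k (rk A) (rk B) = k' (rk A) (rk B)) ->
  chain e S j z -> z *m k = z *m k'.
Proof.
move=> kk cz; apply: chain_ext => a B.
rewrite !mxE !(reindex _ (onW_bij _ (@enum_rank_bij {set T}))) /=.
apply: eq_bigr => A _; case: (boolP (face e S j A)) => [/kk -> //|nA].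
by rewrite cz // !mul0r.
Qed.

(** Over a field, fillings of boundaries can be chosen linearly, which turns acyclicity above [r]
    into a contracting homotopy there. *)
Lemma acyclic_homotopy S r :
  (forall j, (r < j)%N -> acyclic e K S j) ->
  exists2 k : 'M[K]_N, raises S k &
    forall j (z : 'rV_N), (r < j)%N -> chain e S j z -> z *m d *m k + z *m k *m d = z.
Proof.
move=> ac.
(* The pseudo-inverse supplies a linear choice: a boundary [y] with [j] vertices per face satisfies
   [y *m g j *m d = y]. *)
pose g j : 'M[K]_N := pinvmx (emb e K S j.+1 *m d) *m emb e K S j.+1.
pose k0 := kmx (fun A B => if face e S #|A| A then g #|A| (rk A) (rk B) else 0).
have k0E m j (z : 'M_(m, N)) : chain e S j z -> z *m k0 = z *m g j.
  by apply: chain_rows => A B fA; rewrite mxE !enum_rankK (face_card fA) fA.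
have k0c m j (z : 'M_(m, N)) : chain e S j z -> chain e S j.+1 (z *m k0).
  by move=> cz; rewrite (k0E _ _ _ cz) mulmxA; apply: chain_emb.
have k0d j (w : 'rV_N) : chain e S j.+1 w -> w *m d *m k0 *m d = w *m d.
  move=> cw; rewrite (k0E _ _ _ (chain_bdm cw)) /g -(mulmxA (w *m d))
    -(mulmxA _ (emb _ _ _ _)).
  rewrite [LHS]mulmxA mulmxKpV //.
  by rewrite -{1}(chainK cw) -mulmxA submxMl.
(* With this correction [k0] is applied to [z - z *m d *m k0], which is a cycle, hence a boundary
   above [r]; the term [z *m d *m k1] reduces to [z *m d *m k0]. *)
pose k1 := k0 - d *m k0 *m k0.
(* Rows of non-faces are set to zero, as [raises] demands. *)
pose k := kmx (fun A B => if face e S #|A| A then k1 (rk A) (rk B) else 0).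
have kE m j (z : 'M_(m, N)) : chain e S j z -> z *m k = z *m k1.
  by apply: chain_rows => A B fA; rewrite [LHS]mxE !enum_rankK (face_card fA) fA.
have k1c m j (z : 'M_(m, N)) : chain e S j z -> chain e S j.+1 (z *m k1).
  move=> cz; rewrite mulmxBr; apply: chainD; first exact: k0c.
  apply: chainN; rewrite !mulmxA; apply: (k0c); case: j cz => [|j] cz.
    by rewrite (chain_bdm0 cz) mul0mx => a B _; rewrite mxE.
  by apply: k0c; apply: chain_bdm.
exists k => [A B nAB|j z rj cz].
  rewrite mxE !enum_rankK; case: ifP => // fA; rewrite fA /= in nAB.
  have := k1c _ #|A| (delta_mx 0 (rk A) : 'rV_N) _ 0 B nAB.
  rewrite -rowE mxE; apply=> a X nX; rewrite mxE ord1 eqxx /=.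
  by case: eqP => // /enum_rank_inj XA; rewrite XA fA in nX.
have czd : chain e S j.-1 (z *m d).
  by case: j rj cz => // j _; apply: chain_bdm.
rewrite (kE _ _ _ czd) (kE _ _ _ cz) /k1 !mulmxBr !mulmxBl !mulmxA bdmK !mul0mx subr0.
pose y := z - z *m d *m k0.
have cy : chain e S j y.
  apply: (chainD cz (chainN _)); case: j rj cz czd => // j _ cz czd; exact: k0c.
have [|w cw wd] := ac _ rj y cy.
  case: j rj cz {czd cy} => // j _ cz; rewrite mulmxBl (k0d _ _ cz) subrr //.
have : y *m k0 *m d = y by rewrite -wd (k0d _ _ cw).
rewrite !mulmxBl => ->; rewrite addrC subrK //.
Qed.

End Homotopy.

(** * The join of two independence complexes *)

Section Kunneth.
Local Open Scope ring_scope.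
Variables (T : finType) (e : rel T) (K : fieldType).
Implicit Types (A B S X : {set T}) (u v : T) (i j : nat).
Local Notation N := #|{: {set T}}|.
Local Notation rk := (@enum_rank {set T}).
Local Notation d := (bdm T K).
Variables C D : {set T}.
Hypothesis sym : symmetric e.
Hypothesis dCD : [disjoint C & D].
Hypothesis eCD : forall u v, u \in C -> v \in D -> ~~ e u v.

(* Sign of the permutation sorting the concatenation of [A] and [B]. *)
Definition shuffle_sign A B : K := \prod_(a in A) sg K B a.

Definition degree_sign : 'M[K]_N := diag_mx (\row_(i < N) (-1) ^+ #|(enum_val i : {set T})|).

(* Chains of the join on [C :|: D] as matrices indexed by pairs of faces; [dtens] is
   the differential of the tensor product. *)
Definition tens (f : 'rV[K]_N) : 'M[K]_N :=
  kmx (fun A B => if (A \subset C) && (B \subset D)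
                  then shuffle_sign A B * f 0 (rk (A :|: B)) else 0).

Definition untens (F : 'M[K]_N) : 'rV[K]_N :=
  \row_(i < N) let X : {set T} := enum_val i in
         if X \subset C :|: D
         then shuffle_sign (X :&: C) (X :&: D) * F (rk (X :&: C)) (rk (X :&: D)) else 0.

Definition dtens (F : 'M[K]_N) := d^T *m F + degree_sign *m F *m d.

Definition bichain n (F : 'M[K]_N) := forall A B,
  ~~ [&& face e C #|A| A, face e D #|B| B & #|A| + #|B| == n]%N ->
  F (rk A) (rk B) = 0.

Lemma shuffle_sign2 A B : shuffle_sign A B * shuffle_sign A B = 1.
Proof. by rewrite -big_split big1 // => a _; exact: sgM. Qed.

Lemma shuffle_signUl A B v : v \notin A ->
  shuffle_sign (v |: A) B = shuffle_sign A B * sg K B v.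
Proof. by move=> vA; rewrite /shuffle_sign big_setU1 //= mulrC. Qed.

(** Inserting [v] into [B] contributes one sign per element of [A] above [v]; multiplied by the sign
    of [#|A|], this becomes one sign per element below [v]. *)
Lemma shuffle_signUr A B v : v \notin B -> v \notin A ->
  (-1) ^+ #|A| * shuffle_sign A (v |: B) = shuffle_sign A B * sg K A v.
Proof.
move=> vB vA; rewrite /sg posE /shuffle_sign expr_sum -prodr_const -!big_split /=.
apply: eq_bigr => a aA; rewrite sgU1 // mulrCA; congr (_ * _).
have va : v != a by apply: contraNneq vA => ->.
by rewrite (sg_anti K va) mulN1r opprK.
Qed.

Lemma degree_signE m (M : 'M_(N, m)) A b :
  (degree_sign *m M) (rk A) b = (-1) ^+ #|A| * M (rk A) b.
Proof. by rewrite mul_diag_mx !mxE enum_rankK. Qed.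

Lemma chain_ext2 (M M' : 'M[K]_N) :
  (forall A B, M (rk A) (rk B) = M' (rk A) (rk B)) -> M = M'.
Proof. by move=> H; apply: chain_ext => i B; rewrite -(enum_valK i). Qed.

Lemma degree_signK (M : 'M_N) : degree_sign *m (degree_sign *m M) = M.
Proof.
apply: chain_ext2 => A B.
by rewrite !degree_signE mulrA -expr2 sqrr_sign mul1r.
Qed.

Lemma bdm_trE m (M : 'M_(N, m)) A b :
  (d^T *m M) (rk A) b = \sum_(v | v \notin A) sg K A v * M (rk (v |: A)) b.
Proof.
rewrite -[M]trmxK -trmx_mul mxE bdmE; apply: eq_bigr => v _; by rewrite !mxE.
Qed.

Lemma tensE f A B : tens f (rk A) (rk B) = if (A \subset C) && (B \subset D)
  then shuffle_sign A B * f 0 (rk (A :|: B)) else 0.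
Proof. by rewrite mxE !enum_rankK. Qed.

Lemma untensE F X a : untens F a (rk X) = if X \subset C :|: D
  then shuffle_sign (X :&: C) (X :&: D) * F (rk (X :&: C)) (rk (X :&: D)) else 0.
Proof. by rewrite mxE !enum_rankK. Qed.

Lemma disj_C v : v \in C -> v \notin D.
Proof. by move=> vC; rewrite (disjointFr dCD vC). Qed.

Lemma disj_D v : v \in D -> v \notin C.
Proof. by move=> vD; rewrite (disjointFl dCD vD). Qed.

Lemma cut_C A B : A \subset C -> B \subset D -> (A :|: B) :&: C = A.
Proof.
move=> /subsetP sA /subsetP sB; apply/setP => v; rewrite !inE.
case: (boolP (v \in A)) => [/sA -> //|vA] /=.
by case: (boolP (v \in B)) => //= /sB /disj_D /negPf.
Qed.

Lemma cut_D A B : A \subset C -> B \subset D -> (A :|: B) :&: D = B.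
Proof.
move=> /subsetP sA /subsetP sB; apply/setP => v; rewrite !inE orbC.
case: (boolP (v \in B)) => [/sB -> //|vB] /=.
by case: (boolP (v \in A)) => //= /sA /disj_C /negPf.
Qed.

Lemma cut_U X : X \subset C :|: D -> (X :&: C) :|: (X :&: D) = X.
Proof. by move=> sX; rewrite -setIUr; apply/setIidPl. Qed.

Lemma disjoint_sub A B : A \subset C -> B \subset D -> [disjoint A & B].
Proof. by move=> sA sB; exact: disjointW sA sB dCD. Qed.

(** As no edge joins [C] to [D], the independence complex of the union is the join of the two
    complexes. *)
Lemma face_tens n A B : A \subset C -> B \subset D ->
  face e (C :|: D) n (A :|: B) =
  [&& face e C #|A| A, face e D #|B| B & #|A| + #|B| == n]%N.
Proof.
move=> sA sB; rewrite /face !eqxx sA sB !andbT setUSS //=.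
rewrite cardsU disjoint_setI0 ?disjoint_sub // cards0 subn0 andbA; congr (_ && _).
apply/idP/andP => [iAB|[iA iB]].
  by split; apply: independentS iAB; rewrite ?subsetUl ?subsetUr.
apply/forall_inP => u /setUP[] uX; apply/forall_inP => v /setUP[] vX.
- by move/forall_inP: (forall_inP iA u uX); apply.
- by apply: eCD; [apply: (subsetP sA)|apply: (subsetP sB)].
- by rewrite sym; apply: eCD; [apply: (subsetP sA)|apply: (subsetP sB)].
- by move/forall_inP: (forall_inP iB u uX); apply.
Qed.

Lemma bichainP n F A B : bichain n F -> F (rk A) (rk B) != 0 ->
  [/\ A \subset C, B \subset D, face e C #|A| A, face e D #|B| B & (#|A| + #|B|)%N = n].
Proof.
move=> bF nz; case: (boolP [&& face e C #|A| A, face e D #|B| B & #|A| + #|B| == n]%N).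
  by case/and3P=> fA fB /eqP s; split=> //; [case/and3P: fA|case/and3P: fB].
by move/bF/eqP; rewrite (negPf nz).
Qed.

Lemma bichain_tens n f : chain e (C :|: D) n f -> bichain n (tens f).
Proof.
move=> cf A B nAB; rewrite tensE; case: ifP => // /andP[sA sB].
by rewrite cf ?mulr0 // face_tens.
Qed.

Lemma tens_untens n F : bichain n F -> tens (untens F) = F.
Proof.
move=> bF; apply: chain_ext2 => A B; rewrite tensE; case: ifP => [/andP[sA sB]|nAB].
  by rewrite untensE setUSS // cut_C // cut_D // mulrA shuffle_sign2 mul1r.
apply/esym/eqP; apply: contraFT nAB => /(bichainP bF)[-> -> //].
Qed.

Lemma chain_untens n F : bichain n F -> chain e (C :|: D) n (untens F).
Proof.
move=> bF a X nX; rewrite untensE; case: ifP => // sX.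
rewrite -(cut_U sX) face_tens ?subsetIr // in nX.
by rewrite bF ?mulr0.
Qed.

Lemma tens_inj m n f g : chain e (C :|: D) m f -> chain e (C :|: D) n g ->
  tens f = tens g -> f = g.
Proof.
move=> cf cg fg; apply: chain_ext => a X; rewrite (ord1 a).
case: (boolP (X \subset C :|: D)) => sX; last first.
  by rewrite cf ?cg //; apply: contra sX => /and3P[].
move/matrixP: fg => /(_ (rk (X :&: C)) (rk (X :&: D))).
rewrite !tensE !subsetIr cut_U //= => /(congr1 ( *%R (shuffle_sign (X :&: C) (X :&: D)))).
by rewrite !mulrA shuffle_sign2 !mul1r.
Qed.

(** Vertices removed from the part in [C] give the first term of [dtens], those removed from the
    part in [D] give the second with its degree sign; vertices outside both carry no coefficient. *)
Lemma tens_bdm n f : chain e (C :|: D) n f -> tens (f *m d) = dtens (tens f).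
Proof.
move=> cf; apply: chain_ext2 => A B.
rewrite tensE [RHS]mxE bdm_trE -mulmxA degree_signE !bdmE [X in _ = _ + X]mulr_sumr.
rewrite [X in _ = X + _]big_mkcond [X in _ = _ + X]big_mkcond -big_split /=.
case: ifP => [/andP[sA sB]|nAB]; last first.
  rewrite big1 // => v _; rewrite !tensE !subUset.
  by move: nAB; case: (A \subset C); case: (B \subset D) => //= _;
    rewrite ?andbF !mulr0 !if_same ?mulr0 addr0.
rewrite big_mkcond mulr_sumr; apply: eq_bigr => v _; rewrite !tensE !subUset sA sB !sub1set
  !andbT /= inE negb_or.
case: (boolP (v \in C)) => vC.
  have vB : v \notin B by apply: contraL vC => /(subsetP sB)/disj_D.
  rewrite (negPf (disj_C vC)) vB andbT /= !mulr0 addr0; case: ifP => [vA|]; rewrite ?mulr0 //.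
  rewrite sgU ?disjoint_sub // shuffle_signUl // setUA !mulrA; congr (_ * _).
  by rewrite -!mulrA mulrCA.
have vA : v \notin A by apply: contra vC => /(subsetP sA).
rewrite vA /= mulr0 add0r; case: (boolP (v \in D)) => vD.
  case: ifP => vB; rewrite ?mulr0 // sgU ?disjoint_sub //.
  by rewrite (setUCA A) !mulrA -shuffle_signUr //; congr (_ * _); rewrite mulrAC.
rewrite cf ?mulr0 ?if_same ?mulr0 //.
by apply/negP => /and3P[]; rewrite !subUset sub1set inE (negPf vC) (negPf vD).
Qed.

Lemma bichain_row n F A : bichain n F -> chain e D (n - #|A|) (row (rk A) F).
Proof.
move=> bF a B nB; rewrite mxE; apply/eqP; apply: contraNT nB => /(bichainP bF)[_ _ _ fB <-].
by rewrite addKn.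
Qed.

Lemma bichain_col n F B : bichain n F -> chain e C (n - #|B|) (row (rk B) F^T).
Proof.
move=> bF a A nA; rewrite !mxE; apply/eqP; apply: contraNT nA => /(bichainP bF)[_ _ fA _ <-].
by rewrite addnK.
Qed.

Lemma bichainD n F G : bichain n F -> bichain n G -> bichain n (F + G).
Proof. by move=> bF bG A B nAB; rewrite mxE bF ?bG ?addr0. Qed.

Lemma bichain_degree_sign n F : bichain n F -> bichain n (degree_sign *m F).
Proof. by move=> bF A B nAB; rewrite degree_signE bF ?mulr0. Qed.

Lemma bichain_raise_r n F k : raises e D k -> bichain n F -> bichain n.+1 (F *m k).
Proof.
move=> rk bF A B nAB; rewrite mxE (reindex _ (onW_bij _ (@enum_rank_bij {set T}))) big1 //=
  => X _.
case: (boolP (F (enum_rank A) (enum_rank X) == 0)) => [/eqP ->|]; first by rewrite mul0r.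
case/(bichainP bF) => _ _ fA fX s; rewrite rk ?mulr0 //; apply: contra nAB.
case/andP=> _ fB; have cB := face_card fB.
by rewrite fA cB fB -s addnS eqxx.
Qed.

Lemma bichain_raise_l n F k : raises e C k -> bichain n F -> bichain n.+1 (k^T *m F).
Proof.
move=> rk bF A B nAB; rewrite mxE (reindex _ (onW_bij _ (@enum_rank_bij {set T}))) big1 //=
  => X _.
case: (boolP (F (enum_rank X) (enum_rank B) == 0)) => [/eqP ->|]; first by rewrite mulr0.
case/(bichainP bF) => _ _ fX fB s; rewrite mxE rk ?mul0r //; apply: contra nAB.
case/andP=> _ fA; have cA := face_card fA.
by rewrite fB cA fA -s addSn eqxx.
Qed.

(** An operator of odd degree anticommutes with the grading involution. *)
Lemma degree_sign_raise S k (F : 'M[K]_N) : raises e S k ->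
  degree_sign *m (k^T *m F) = - (k^T *m (degree_sign *m F)).
Proof.
move=> rk; apply: chain_ext2 => A B.
rewrite degree_signE !mxE mulr_sumr -sumrN (reindex _ (onW_bij _ (@enum_rank_bij {set T})))
  [RHS](reindex _ (onW_bij _ (@enum_rank_bij {set T}))) /=.
apply: eq_bigr => X _; rewrite degree_signE mxE.
case: (boolP (face e S #|X| X && face e S #|X|.+1 A)) => [/andP[_ fA]|nXA].
  by rewrite (face_card fA) exprS mulN1r mulNr; congr (- _); rewrite mulrCA.
by rewrite rk // !(mul0r, mulr0) oppr0.
Qed.

Lemma degree_sign_bdm (F : 'M[K]_N) :
  degree_sign *m (d^T *m F) = - (d^T *m (degree_sign *m F)).
Proof.
apply: chain_ext2 => A B.
rewrite degree_signE [RHS]mxE !bdm_trE mulr_sumr -sumrN.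
apply: eq_bigr => v vA; rewrite degree_signE cardsU1 vA exprS mulN1r mulNr mulrN opprK.
by rewrite mulrCA.
Qed.

Lemma bichain_bdm_r n F : bichain n.+1 F -> bichain n (F *m d).
Proof.
move=> bF A B; apply: contraNeq; rewrite bdmE => nz.
have [v vB] : exists2 v, v \notin B & F (rk A) (rk (v |: B)) != 0.
  case: (pickP (fun v => (v \notin B) && (F (rk A) (rk (v |: B)) != 0))) => [v /andP[]|F0].
    by exists v.
  case/eqP: nz; rewrite big1 // => v vB; move: (F0 v); rewrite vB /= => /negbFE/eqP ->.
  by rewrite mulr0.
case/(bichainP bF) => _ _ fA fB; rewrite cardsU1 vB add1n addnS => -[<-].
by rewrite fA eqxx andbT /=; apply: (face_setU1 vB); rewrite cardsU1 vB add1n in fB.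
Qed.

(* With [p = 1 - (d l + l d)] vanishing in degrees above [s], [F] is homologous to
   [F p]; the latter lives in degrees at most [s] on [D], hence above [r] on [C],
   where the homotopy [k] contracts it. *)
Lemma kunneth_acyclic r s n :
  (forall j, (r < j)%N -> acyclic e K C j) -> (forall j, (s < j)%N -> acyclic e K D j) ->
  (r + s < n)%N -> acyclic e K (C :|: D) n.
Proof.
move=> /acyclic_homotopy[k kr hk] /acyclic_homotopy[l lr hl] rsn f cf fd.
case: n rsn cf => // n rsn cf.
pose F := tens f; have bF : bichain n.+1 F by apply: bichain_tens.
have dF : dtens F = 0.
  rewrite -(tens_bdm cf) fd; apply: chain_ext2 => A B.
  by rewrite tensE !mxE mulr0 if_same.
(* The filling will be [G + G1]: the differential of [G] is [F - F1], and that of [G1] is [F1]. *)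
pose G := degree_sign *m F *m l; pose F1 := F - (F *m d *m l + F *m l *m d).
pose G1 := k^T *m F1.
have bG : bichain n.+2 G by apply: bichain_raise_r lr _; apply: bichain_degree_sign.
have bFl : bichain n.+1 (F *m d *m l + F *m l *m d).
  apply: bichainD; first exact: bichain_raise_r lr (bichain_bdm_r bF).
  exact: bichain_bdm_r (bichain_raise_r lr bF).
have bF1 : bichain n.+1 F1.
  by move=> A B nAB; rewrite [LHS]mxE [X in _ + X]mxE bF // bFl // subr0.
have bG1 : bichain n.+2 G1 by apply: bichain_raise_l.
have trF : d^T *m F = - (degree_sign *m F *m d) by apply/eqP; rewrite -addr_eq0; apply/eqP.
have trEF : d^T *m (degree_sign *m F) = F *m d.
  by rewrite -[LHS]opprK -degree_sign_bdm trF mulmxN opprK -mulmxA degree_signK.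
have dG : dtens G = F - F1.
  rewrite /dtens /G /F1 opprB [RHS]addrCA subrr addr0 (mulmxA d^T) trEF.
  by rewrite -(mulmxA _ F l) degree_signK.
have trF1 : d^T *m F1 = - (degree_sign *m F1 *m d).
  rewrite /F1 !mulmxBr !mulmxDr !mulmxA trF !mulNmx mulmxBl mulmxDl !bdmK mul0mx.
  by rewrite oppr0 add0r addr0 opprK opprB addrC.
(* Row [A] of [F] sits in degree [#|B|] on [D]; above [s] the homotopy identity for [l] makes the
   subtracted term equal to [F]. *)
have F1_0 A B : (s < #|B|)%N -> F1 (rk A) (rk B) = 0.
  move=> sB; apply/eqP/negP => /negP nz.
  have [_ _ _ _ cAB] := bichainP bF1 nz; case/eqP: nz.
  have jA : (s < n.+1 - #|A|)%N by rewrite -cAB addKn.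
  have /matrixP/(_ 0 (rk B)) := hl _ _ jA (bichain_row (A := A) bF).
  by rewrite -!row_mul -linearD /= !mxE => ->; rewrite subrr.
have dG1 : dtens G1 = F1.
  rewrite /dtens /G1 (degree_sign_raise _ kr) mulNmx -[k^T *m _ *m d]mulmxA -mulmxN -trF1.
  apply: trmx_inj; rewrite [LHS]linearD /= !trmx_mul !trmxK; apply/row_matrixP => b.
  rewrite linearD /= !row_mul addrC -(enum_valK b); set B : {set T} := enum_val b.
  have [sB|Bs] := ltnP s #|B|.
    have -> : row (rk B) F1^T = 0.
      by apply: chain_ext => a A; rewrite 2![LHS]mxE F1_0 // mxE.
    by rewrite !mul0mx addr0.
  (* Here [#|B|] is at most [s], so the complementary degree on [C] exceeds [r]. *)
  apply: hk (bichain_col bF1); rewrite ltn_subRL.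
  by apply: leq_ltn_trans rsn; rewrite addnC leq_add2l.
have bGG : bichain n.+2 (G + G1) by apply: bichainD.
exists (untens (G + G1)); first exact: chain_untens.
have cu := chain_untens bGG.
apply: (tens_inj (chain_bdm cu) cf).
rewrite (tens_bdm cu) (tens_untens bGG) -/F.
rewrite /dtens mulmxDr mulmxDr mulmxDl addrACA -/(dtens G) -/(dtens G1) dG dG1 subrK //.
Qed.

(** If the union were acyclic in degree [i + j], then for any cycle [z] on [C] the product of [z]
    and [h] would be the differential of some [W]; pairing the [D] side of [W] with the cocycle [om]
    then fills [z], so [C] would be acyclic in degree [i]. *)
Lemma kunneth_red_hom i j :
  red_hom_nonzero e K C i -> red_hom_nonzero e K D j ->
  red_hom_nonzero e K (C :|: D) (i + j)%N.
Proof.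
move=> hC /red_hom_cocycle[h [om [ch hd ho om0 omd]]].
apply: contraLR hC => /red_homN_acyclic ac; apply: acyclic_red_homN => z cz zd.
pose F := z^T *m h.
have FE A B : F (rk A) (rk B) = z 0 (rk A) * h 0 (rk B).
  by rewrite mxE big_ord1 mxE.
have bF : bichain (i + j)%N F.
  move=> A B nAB; rewrite FE; apply/eqP; apply: contraNT nAB.
  rewrite mulf_eq0 negb_or => /andP[zA hB].
  have fA : face e C i A by apply: contraNT zA => /cz ->.
  have fB : face e D j B by apply: contraNT hB => /ch ->.
  by rewrite !(face_card fA) !(face_card fB) fA fB eqxx.
have dF : dtens F = 0.
  by rewrite /dtens /F !mulmxA -trmx_mul zd trmx0 mul0mx -!mulmxA hd !mulmx0 addr0.
have cu := chain_untens bF.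
have [|w cw wd] := ac _ cu.
  have : tens (untens F *m d) = tens 0.
    rewrite (tens_bdm cu) (tens_untens bF) dF; apply: chain_ext2 => A B.
    by rewrite tensE !mxE mulr0 if_same.
  case: (i + j)%N cu => [|n] cu; first by rewrite (chain_bdm0 cu).
  by apply: (tens_inj (n := 0) (chain_bdm cu)) => a X _; rewrite mxE.
pose W := tens w; have bW : bichain (i + j).+1%N W by apply: bichain_tens.
have dW : dtens W = F by rewrite -(tens_bdm cw) wd (tens_untens bF).
(* Rows of degree [j.+1] on [D] vanish by the cocycle condition; the boundaries of all others miss
   the support of [om]. *)
have Wd0 : W *m d *m om = 0.
  apply/row_matrixP => b; rewrite -(enum_valK b) row0 !row_mul.
  have := bichain_row (A := enum_val b) bW.
  have [->|mj] := eqVneq ((i + j).+1 - #|enum_val b|)%N j.+1; first exact: omd.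
  case: (_ - _)%N mj => [|m] mj cr; first by rewrite (chain_bdm0 cr) mul0mx.
  apply/rowP => c; rewrite (ord1 c) [RHS]mxE mxE.
  rewrite (reindex _ (onW_bij _ (@enum_rank_bij {set T}))) big1 //= => B _.
  case: (boolP (face e D j B)) => [fB|nB]; last by rewrite om0 ?mulr0.
  rewrite (chain_bdm cr) ?mul0r //; apply: contra mj => fB'.
  by rewrite -(face_card fB) (face_card fB').
exists (W *m om)^T.
  move=> a A nA; rewrite (ord1 a) mxE mxE (reindex _ (onW_bij _ (@enum_rank_bij {set T})))
    big1 //= => B _.
  case: (boolP (face e D j B)) => [fB|nB]; last by rewrite om0 ?mulr0.
  have [->|nz] := eqVneq (W (rk A) (rk B)) 0; first by rewrite mul0r.
  have [_ _ fA _] := bichainP bW nz; rewrite (face_card fB) -addSn => /addIn cA.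
  by rewrite -cA fA in nA.
apply: trmx_inj; rewrite trmx_mul trmxK.
rewrite -[RHS]mulmx1 -ho mulmxA -/F -dW mulmxDl -!(mulmxA degree_sign) Wd0.
by rewrite mulmx0 addr0 mulmxA.
Qed.

End Kunneth.

(** * Regularity *)

Section Regularity.
Variables (T : finType) (e : rel T) (K : fieldType).
Implicit Types (A B S V : {set T}) (u v x y : T) (i j : nat).
Hypothesis se : simple_graph e.

Lemma reg_leP V n :
  (forall S j, S \subset V -> red_hom_nonzero e K S j -> j <= n) -> reg e K V <= n.
Proof.
move=> H; apply/bigmax_leqP => S SV; apply/bigmax_leqP => j hj.
exact: H SV hj.
Qed.

(** Nonzero homology requires a face with [j] vertices, so [j] is at most [#|T|] and lies in the
    range of the maximum. *)
Lemma leq_reg V S j : S \subset V -> red_hom_nonzero e K S j -> j <= reg e K V.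
Proof.
move=> SV hj; have jT : j < #|T|.+2.
  have : 0 < size (faces e S j) by apply: leq_ltn_trans hj.
  case E : (faces e S j) => [//|A s] _.
  have fA : face e S j A by rewrite -mem_faces E mem_head.
  by rewrite -(face_card fA); rewrite ltnS leqW // max_card.
rewrite /reg; apply: leq_trans (leq_bigmax_cond S SV).
exact: (leq_bigmax_cond (Ordinal jT)).
Qed.

Lemma regS V V' : V \subset V' -> reg e K V <= reg e K V'.
Proof. by move=> VV; apply: reg_leP => S j SV; apply: leq_reg; apply: subset_trans SV VV. Qed.

(** Positivity excludes the default value 0 of an empty maximum. *)
Lemma reg_witness V : 0 < reg e K V ->
  exists2 S : {set T}, S \subset V & red_hom_nonzero e K S (reg e K V).
Proof.
move=> rV; apply/exists_inP; apply: contraLR rV => /exists_inPn nS.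
rewrite -leqNgt; have [//|rV] := leqP (reg e K V) 0.
have: reg e K V <= (reg e K V).-1; last by case: (reg e K V) rV => // n _; rewrite ltnn.
apply: reg_leP => S j SV hj; have := leq_reg SV hj.
rewrite leq_eqVlt => /orP[/eqP jE|]; last by case: (reg e K V).
by have := nS S SV; rewrite -jE hj.
Qed.

Lemma acyclic_reg V S j : S \subset V -> reg e K V < j -> acyclic e K S j.
Proof.
by move=> SV rj; apply: red_homN_acyclic; apply: contraL rj => /(leq_reg SV); rewrite leqNgt.
Qed.

(** A class above both bounds would live on some [S] containing [x], where the deletion and, one
    degree lower, the link are acyclic. *)
Lemma reg_link_deletion V x : x \in V ->
  reg e K V <= maxn (reg e K (V :\ x)) (reg e K (nbd_compl e V x)).+1.
Proof.
move=> xV; apply: reg_leP => S [//|j] SV hj; rewrite leqNgt; apply/negP;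
  rewrite gtn_max => /andP[rD rL].
case: (boolP (x \in S)) => xS; last first.
  have SVx : S \subset V :\ x by rewrite subsetD1 SV.
  by have := leq_reg SVx hj; rewrite leqNgt rD.
move: hj; apply/negP; apply: acyclic_red_homN; apply: acyclic_link_deletion xS _ _ => //.
  by apply: acyclic_reg rD; apply: setSD.
apply: acyclic_reg rL; apply/subsetP => v; rewrite !inE => /andP[/(subsetP SV) -> //].
Qed.

Lemma reg_disjoint (C D : {set T}) : [disjoint C & D] ->
  (forall u v, u \in C -> v \in D -> ~~ e u v) ->
  reg e K (C :|: D) = reg e K C + reg e K D.
Proof.
case: (se) => sym _ dCD eCD; apply/eqP; rewrite eqn_leq; apply/andP; split.
  apply: reg_leP => S j SCD hj; rewrite leqNgt; apply/negP => rj; move: hj; apply/negP.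
  apply: acyclic_red_homN; rewrite -(cut_U SCD).
  have sC := subsetIr S C; have sD := subsetIr S D.
  apply: (kunneth_acyclic sym (disjointW sC sD dCD) _ _ _ rj).
  - by move=> u v /(subsetP sC) uC /(subsetP sD) vD; apply: eCD.
  - by move=> i; apply: acyclic_reg.
  - by move=> i; apply: acyclic_reg.
(* If one regularity is 0, monotonicity suffices; otherwise both are attained and the classes
   multiply. *)
have [->|] := posnP (reg e K C); first by apply: regS; apply: subsetUr.
have [->|] := posnP (reg e K D); first by rewrite addn0 => _; apply: regS; apply: subsetUl.
move=> /reg_witness[S2 s2 h2] /reg_witness[S1 s1 h1].
apply: (leq_reg (setUSS s1 s2)); apply: kunneth_red_hom => //.
  exact: disjointW s1 s2 dCD.
by move=> u v /(subsetP s1) uC /(subsetP s2) vD; apply: eCD.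
Qed.

(** The complex of an edge is two isolated points: at least two vertices, at most one empty face and
    no face of size 2 leave nonzero homology at index 1. *)
Lemma reg_edge x y : e x y -> 0 < reg e K [set x; y].
Proof.
case: (se) => sym irr exy; apply: (leq_reg (subxx _)).
have xy : x != y by apply: contraTneq exy => ->; rewrite irr.
have s0 : size (faces e [set x; y] 0) <= 1.
  rewrite -[1]/(size [:: set0 : {set T}]); apply: uniq_leq_size (uniq_faces _ _ _) _ => A.
  by rewrite mem_faces inE => /and3P[_ _]; rewrite cards_eq0.
have s2 : size (faces e [set x; y] 2) = 0.
  apply/eqP; rewrite size_eq0; apply/eqP; case E: (faces _ _ _) => [//|A s].
  have : A \in faces e [set x; y] 2 by rewrite E mem_head.
  rewrite mem_faces => /and3P[sA iA cA].
  have AE : A = [set x; y] by apply/eqP; rewrite eqEcard sA (eqP cA) cards2 xy.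
  move/forall_inP: iA => /(_ x); rewrite AE set21 => /(_ isT)/forall_inP/(_ y).
  by rewrite set22 exy => /(_ isT).
have s1 : 2 <= size (faces e [set x; y] 1).
  rewrite -[2]/(size [:: [set x]; [set y]]); apply: uniq_leq_size.
    by rewrite /= inE andbT (inj_eq set1_inj).
  move=> A; rewrite !inE mem_faces /face => /orP[] /eqP ->;
    rewrite sub1set !inE eqxx ?orbT cards1 eqxx andbT /=;
    by apply/forall_inP => u /set1P ->; apply/forall_inP => v /set1P ->; rewrite irr.
rewrite /red_hom_nonzero; apply: leq_trans s1; rewrite ltnS.
apply: leq_trans (leq_add (rank_leq_col _) (rank_leq_row _)) _.
by rewrite s2 addn0.
Qed.

End Regularity.

(** * Bridges in prime graphs *)

Section Bridge.
Variables (T : finType) (e : rel T) (K : fieldType).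
Implicit Types (A B S V : {set T}) (u v x y : T).
Hypothesis se : simple_graph e.
Local Notation r := (reg e K).

Lemma prime_no_bridge A x y z :
  (forall v, r (setT :\ v) < r setT) ->
  x \in A -> y \notin A -> e x y ->
  (forall u v, u \in A -> v \notin A -> e u v -> (u == x) && (v == y)) ->
  z \in A -> e x z -> False.
Proof.
case: (se) => sym irr pr xA yA exy br zA exz.
have xNbr u v : u \in A -> v \notin A -> (u != x) || (v != y) -> ~~ e u v.
  by move=> uA vA; apply: contraL => /(br _ _ uA vA)/andP[/eqP -> /eqP ->]; rewrite !eqxx.
have xy : x != y by apply: contraNneq yA => <-.
pose P := nbd_compl e A x; pose P' := A :\ x.
pose Q' := nbd_compl e (~: A) y; pose Q := ~: A :\ y.
have PA u : u \in P -> [/\ u \in A, u != x & ~~ e x u] by rewrite inE => /and3P[].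
have QA v : v \in Q' -> [/\ v \notin A, v != y & ~~ e y v] by rewrite !inE => /and3P[].
have dj (C D : {set T}) : C \subset A -> D \subset ~: A -> [disjoint C & D].
  move=> CA DA; by apply: disjointW CA DA _; rewrite -setI_eq0 setICr.
have add (C D : {set T}) : C \subset A -> D \subset ~: A -> (x \notin C) || (y \notin D) ->
    r (C :|: D) = r C + r D.
  move=> CA DA nxy; apply: reg_disjoint => // [|u v uC vD]; first exact: dj.
  apply: xNbr; first exact: (subsetP CA).
    by have := subsetP DA v vD; rewrite inE.
  rewrite -negb_and; apply: contraL nxy => /andP[/eqP <- /eqP <-].
  by rewrite uC vD.
have sP : P \subset A by apply/subsetP => u /PA[].
have sP' : P' \subset A by apply: subsetDl.
have sQ : Q \subset ~: A by apply: subsetDl.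
have sQ' : Q' \subset ~: A by apply/subsetP => v /QA[]; rewrite inE.
have xP : x \notin P by rewrite inE eqxx andbF.
have xP' : x \notin P' by rewrite setD11.
have yQ : y \notin Q by rewrite setD11.
have yQ' : y \notin Q' by rewrite inE eqxx andbF.
(* Deleting [v] lowers the regularity, so the link term must account for the maximum. *)
have bound v : r setT <= (r (nbd_compl e setT v)).+1.
  have := reg_link_deletion K se (in_setT v); rewrite leq_max => /orP[|//].
  by rewrite leqNgt pr.
have E1 : nbd_compl e setT x = P :|: Q.
  apply/setP => v; rewrite !inE /=; case: (boolP (v \in A)) => vA /=.
    by rewrite andbF orbF.
  have [->|vy] := eqVneq v y; first by rewrite exy !andbF.
  by rewrite xNbr ?vy ?orbT // andbT; apply: contraNneq vA => ->.
have E2 : nbd_compl e setT y = P' :|: Q'.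
  apply/setP => v; rewrite !inE /=; case: (boolP (v \in A)) => vA /=.
    have -> : v != y by apply: contraNneq yA => <-.
    rewrite orbF andbT /=; have [->|vx] := eqVneq v x; first by rewrite sym exy.
    by rewrite sym xNbr // vx.
  by rewrite andbF.
have E3 : setT :\ x = P' :|: ~: A.
  apply/setP => v; rewrite !inE /=; case: (boolP (v \in A)) => vA;
    rewrite ?orbT ?orbF ?andbT //=.
  by apply: contraNneq vA => ->.
have b1 := bound x; have b2 := bound y; have b3 := pr x.
rewrite E1 (add _ _ sP sQ) ?xP // in b1.
rewrite E2 (add _ _ sP' sQ') ?xP' // in b2.
rewrite E3 (add _ _ sP' (subxx _)) ?xP' // in b3.
have PP : r P <= r P'.
  by apply: regS; apply/subsetP => u /PA[uA ux _]; rewrite !inE ux.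
have QB : r Q <= r (~: A) by apply: regS.
(* [P] avoids the neighbours of [x], [Q'] those of [y], and only [x y] crosses; hence [P], the edge
   and [Q'] are mutually non-adjacent and regularities add, the edge giving at least 1. *)
have h : r P + 1 + r Q' <= r (P :|: ([set x; y] :|: Q')).
  rewrite reg_disjoint // => [||u v uP].
  - rewrite -addnA leq_add2l reg_disjoint // => [||u v].
    + by rewrite leq_add2r; apply: reg_edge.
    + rewrite -setI_eq0; apply/eqP/setP => v; rewrite !inE;
      apply/negP => /andP[] /orP[] /eqP ->.
        by rewrite xA.
      by rewrite eqxx andbF.
    + move=> /set2P[] -> /QA[vA vy yv] //; apply: xNbr => //; by rewrite vy orbT.
  - rewrite -setI_eq0; apply/eqP/setP => v; rewrite in_set0;
    apply/negP => /setIP[/PA[vA vx _]].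
    rewrite !inE (negPf vx) vA /= orbF => /eqP vy.
    by rewrite -vy vA in yA.
  - have [uA ux nxu] := PA _ uP.
    case/setUP => [/set2P[] ->|/QA[vA _ _]]; [by rewrite sym|..]; by apply: xNbr => //;
      rewrite ux.
(* Being a neighbour of [x] in [A], the vertex [z] lies in none of the three pieces. *)
have h2 : r (P :|: ([set x; y] :|: Q')) <= r (setT :\ z).
  apply: regS; rewrite subsetD1 subsetT /=; rewrite !inE exz zA /= !andbF !orbF.
  rewrite /= negb_or; apply/andP; split; last by apply: contraNneq yA => <-.
  by apply: contraTneq exz => ->; rewrite irr.
(* Adding [b1] and [b2], then using [QB] and [b3], gives [r setT <= r P + r Q' + 1], while [h], [h2]
   and primality at [z] give the strict reverse. *)
have := pr z; lia.
Qed.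

End Bridge.

(** * Cut vertices and their neighbours *)

Section CutVertex.
Variables (T : finType) (e : rel T) (K : fieldType).
Implicit Types (U : {set T}) (a b u v x y z : T).
Hypothesis se : simple_graph e.
Hypothesis pr : prime_graph e K.

(** Such a [U] is a nonempty union of components of the graph without [x]. *)
Definition separated U x := [/\ x \notin U, U != set0 &
  forall a b, a \in U -> e a b -> b != x -> b \in U].

(** Otherwise [U] would be closed under adjacency in a connected graph and so contain [x]. *)
Lemma separated_neighbour U x : separated U x -> exists2 y, y \in U & e x y.
Proof.
case: se pr => sym _ [[_ con] _] [xU /set0Pn[u uU] cl].
apply/exists_inP; apply: contraNT xU => /exists_inPn nx.
have /(closed_connect (a := mem U)) <- // := con u x (in_setT _) (in_setT _).
have clU a b : e a b -> a \in U -> b \in U.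
  move=> ab aU; apply: (cl a) => //; apply: contraNneq (nx a aU) => <-.
  by rewrite sym.
move=> a b /and3P[ab _ _]; apply/idP/idP; apply: clU => //.
by rewrite sym.
Qed.

(** If [y] were the only neighbour of [x] in [U], the edge [x y] would be a bridge between the
    complement of [U] and [U], with [z] the second neighbour of [x] on its own side. *)
Lemma separated_two_neighbours U x z : separated U x -> z \notin U -> e x z ->
  1 < #|[set y | e x y] :&: U|.
Proof.
move=> sU zU xz; case: (se) => sym _; case: (pr) => _ prm.
have [y yU xy] := separated_neighbour sU; case: sU => xU _ cl.
rewrite ltnNge; apply/negP => le1.
have only v : v \in U -> e x v -> v = y.
  by move=> vU xv; apply: (card_le1_eqP le1); rewrite !inE ?vU ?yU ?andbT.
apply: (@prime_no_bridge _ e K se (~: U) x y z prm) => //; rewrite ?inE ?negbK //.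
move=> a b; rewrite !inE negbK => aU bU ab.
have ax : a = x.
  by apply: contraNeq aU => /(cl b a bU); rewrite sym; apply.
by rewrite ax eqxx /= (only b) // -ax.
Qed.

End CutVertex.

Theorem mainTheorem8 (K : fieldType) (T : finType) (e : rel T) :
  simple_graph e -> bipartite e -> max_degree_le e 3 -> (3 <= #|T|)%N ->
  prime_graph e K -> two_connected e.
Proof.
move=> se _ deg T3 pr; split=> //; split; first by case: pr.
move=> x; split.
  by rewrite -card_gt0; move: (cardsD1 x setT); rewrite in_setT cardsT; lia.
move=> u w ux wx; set R := (R in connect R); case: (se) => sym _.
have symR : connect_sym R by apply: sym_connect_sym => a b;
  rewrite /R sym [_ && (b \in _)]andbC.
apply: contraT => nuw.
(* [U] is the component of [u] after deletion of [x], and [W] collects the remaining vertices, among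
   them [w]. *)
pose U := [set v | (v != x) && connect R u v].
pose W := [set v | (v != x) && ~~ connect R u v].
have step a b : a != x -> b != x -> e a b -> connect R u a = connect R u b.
  move=> ax bx ab; apply: same_connect_r => //; apply: connect1.
  by rewrite /R ab !inE ax bx.
have sU : separated e U x.
  split; first by rewrite inE eqxx.
    by apply/set0Pn; exists u; rewrite inE connect0 andbT; rewrite !inE andbT in ux.
  by move=> a b; rewrite !inE => /andP[ax ua] ab bx; rewrite bx -(step a b).
have sW : separated e W x.
  split; first by rewrite inE eqxx.
    by apply/set0Pn; exists w; rewrite inE nuw andbT; rewrite !inE andbT in wx.
  by move=> a b; rewrite !inE => /andP[ax ua] ab bx; rewrite bx -(step a b).
have [y yU xy] := separated_neighbour se pr sU.
have [z zW xz] := separated_neighbour se pr sW.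
have zU : z \notin U by move: zW; rewrite !inE => /andP[-> /negPf ->].
have yW : y \notin W by move: yU; rewrite !inE => /andP[-> ->].
have nU := separated_two_neighbours se pr sU zU xz.
have nW := separated_two_neighbours se pr sW yW xy.
(* Two neighbours of [x] in [U] and two in the disjoint set [W] give degree at least 4. *)
have := deg x; rewrite -(cardsID U).
have : #|[set y | e x y] :&: W| <= #|[set y | e x y] :\: U|.
  apply: subset_leq_card; apply/subsetP => v; rewrite !inE => /and3P[-> -> /negPf ->].
  by [].
lia.
Qed.
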